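(* Let $(\mathfrak h,[\cdot,\cdot,\cdot]_{\mathfrak h})$ be a finite-dimensional $3$-Lie algebra over $\mathbb K$, where $\mathbb K=\mathbb R$ or $\mathbb C$. Then $\mathfrak h$ has a phase space if and only if it is sub-adjacent to a $3$-pre-Lie algebra, i.e. there is a $3$-pre-Lie algebra structure $\{\cdot,\cdot,\cdot\}$ on the vector space $\mathfrak h$ such that $[x,y,z]_{\mathfrak h}=\{x,y,z\}+\{y,z,x\}+\{z,x,y\}$ for all $x,y,z\in\mathfrak h$.
   Context: All vector spaces are finite-dimensional over $\mathbb K\in\{\mathbb R,\mathbb C\}$. A $3$-Lie algebra is a vector space $\mathfrak g$ with a trilinear skew-symmetric bracket $[\cdot,\cdot,\cdot]_{\mathfrak g}$ satisfying $[x,y,[z,w,v]]=[[x,y,z],w,v]+[z,[x,y,w],v]+[z,w,[x,y,v]]$ for all $x,y,z,w,v$. A $3$-pre-Lie algebra is a vector space $A$ with a trilinear map $\{\cdot,\cdot,\cdot\}:A\otimes A\otimes A\to A$ such that, with $[x,y,z]_C:=\{x,y,z\}+\{y,z,x\}+\{z,x,y\}$, for all elements of $A$: (1) $\{x,y,z\}=-\{y,x,z\}$; (2) $\{x_1,x_2,\{x_3,x_4,x_5\}\}=\{[x_1,x_2,x_3]_C,x_4,x_5\}+\{x_3,[x_1,x_2,x_4]_C,x_5\}+\{x_3,x_4,\{x_1,x_2,x_5\}\}$; (3) $\{[x_1,x_2,x_3]_C,x_4,x_5\}=\{x_1,x_2,\{x_3,x_4,x_5\}\}+\{x_2,x_3,\{x_1,x_4,x_5\}\}+\{x_3,x_1,\{x_2,x_4,x_5\}\}$.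 Then $(A,[\cdot,\cdot,\cdot]_C)$ is a $3$-Lie algebra, called the sub-adjacent $3$-Lie algebra. A symplectic structure on a $3$-Lie algebra $\mathfrak g$ is a nondegenerate skew-symmetric bilinear form $\omega$ with $\omega([x,y,z],w)-\omega([y,z,w],x)+\omega([z,w,x],y)-\omega([w,x,y],z)=0$ for all $x,y,z,w\in\mathfrak g$. A phase space of a $3$-Lie algebra $(\mathfrak h,[\cdot,\cdot,\cdot]_{\mathfrak h})$ is a $3$-Lie algebra structure $[\cdot,\cdot,\cdot]$ on the vector space $\mathfrak h\oplus\mathfrak h^*$ such that the form $\omega(x+\alpha,y+\beta)=\langle\alpha,y\rangle-\langle\beta,x\rangle$ ($x,y\in\mathfrak h$, $\alpha,\beta\in\mathfrak h^*$) is a symplectic structure on it, $(\mathfrak h,[\cdot,\cdot,\cdot]_{\mathfrak h})$ is a $3$-Lie subalgebra of it, and $\mathfrak h^*$ is a $3$-Lie subalgebra of it. *)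

(* Defs.v *)
From mathcomp Require Import all_boot all_order all_algebra.
From mathcomp Require Export complex reals.

Set Implicit Arguments.
Unset Strict Implicit.
Unset Printing Implicit Defensive.

Import GRing.Theory.
Local Open Scope ring_scope.

Record trilinear (K : fieldType) (V : vectType K) (f : V -> V -> V -> V)
    : Prop := {
  trilinear1 : forall y z, linear (fun x => f x y z);
  trilinear2 : forall x z, linear (fun y => f x y z);
  trilinear3 : forall x y, linear (fun z => f x y z)
}.

(* Antisymmetry is required for the two adjacent transpositions, which generate
   all permutations of the arguments. *)
Record is_3Lie (K : fieldType) (V : vectType K) (br : V -> V -> V -> V)
    : Prop := {
  Lie_trilinear : trilinear br;
  Lie_skew12 : forall x y z, br x y z = - br y x z;
  Lie_skew23 : forall x y z, br x y z = - br x z y;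
  Lie_fundamental : forall x y z w v,
    br x y (br z w v) =
      br (br x y z) w v + br z (br x y w) v + br z w (br x y v)
}.

Definition subadjacent (K : fieldType) (A : vectType K) (p : A -> A -> A -> A)
    (x y z : A) : A :=
  p x y z + p y z x + p z x y.

Record is_3preLie (K : fieldType) (A : vectType K) (p : A -> A -> A -> A)
    : Prop := {
  preLie_trilinear : trilinear p;
  preLie_skew : forall x y z, p x y z = - p y x z;
  preLie_der : forall x1 x2 x3 x4 x5,
    p x1 x2 (p x3 x4 x5) =
      p (subadjacent p x1 x2 x3) x4 x5 + p x3 (subadjacent p x1 x2 x4) x5
      + p x3 x4 (p x1 x2 x5);
  preLie_cyc : forall x1 x2 x3 x4 x5,
    p (subadjacent p x1 x2 x3) x4 x5 =
      p x1 x2 (p x3 x4 x5) + p x2 x3 (p x1 x4 x5) + p x3 x1 (p x2 x4 x5)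
}.

(* The form being skew-symmetric, nondegeneracy on the left argument is
   nondegeneracy on both. *)
Record is_symplectic (K : fieldType) (V : vectType K) (br : V -> V -> V -> V)
    (w : V -> V -> K) : Prop := {
  symplectic_bilinear : bilinear_for *%R *%R w;
  symplectic_skew : forall x y, w x y = - w y x;
  symplectic_nondeg : forall x, (forall y, w x y = 0) -> x = 0;
  symplectic_closed : forall x y z t,
    w (br x y z) t - w (br y z t) x + w (br z t x) y - w (br t x y) z = 0
}.

(* The dual space of h is 'Hom(h, K^o), and the pair (x, a) of
   h * 'Hom(h, K^o) stands for x + a in the direct sum. *)
Definition omega (K : fieldType) (h : vectType K) (u v : h * 'Hom(h, K^o)) : K :=
  u.2 v.1 - v.2 u.1.

(* [phase_space_sub] says that h with its given bracket br is a subalgebra for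
   B, [phase_space_dual] that the dual of h is closed under B. *)
Record is_phase_space (K : fieldType) (h : vectType K) (br : h -> h -> h -> h)
    (B : h * 'Hom(h, K^o) -> h * 'Hom(h, K^o) -> h * 'Hom(h, K^o) ->
         h * 'Hom(h, K^o)) : Prop := {
  phase_space_Lie : is_3Lie B;
  phase_space_symplectic : is_symplectic B (@omega K h);
  phase_space_sub : forall x y z, B (x, 0) (y, 0) (z, 0) = (br x y z, 0);
  phase_space_dual : forall a b c : 'Hom(h, K^o),
    exists d : 'Hom(h, K^o), B (0, a) (0, b) (0, c) = (0, d)
}.

(* Main.v *)
Require Import Defs.
From HB Require Import structures.
From mathcomp Require Import all_boot all_order all_algebra.
From mathcomp Require Import ring.
Import GRing.Theory.
Local Open Scope ring_scope.
Local Open Scope complex_scope.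

Set Implicit Arguments.
Unset Strict Implicit.
Unset Printing Implicit Defensive.

(** Both sides of the equivalence are the same datum seen through duality: a
    representation of h on itself, or its contragredient on h^*.

    A representation of a 3-Lie algebra g on V is a skew map rho from pairs of
    elements of g to endomorphisms of V with two axioms, [rep_der] and
    [rep_cyc].  A 3-pre-Lie product p whose cyclic sum is the bracket is
    exactly a representation of the bracket on h itself ([preLie_rep],
    [rep_preLie]): the two long axioms of 3-pre-Lie algebras are the axioms of
    representations once the cyclic sum is written as the bracket.

    The axioms of a representation are stable under passing to the
    contragredient ([rep_contragredient]).  Transposition reverses the order of
    composition, so this needs a version of [rep_cyc] with the two factors
    exchanged and the sign changed ([rep_anticyc]); it follows from the two
    axioms after dividing by 3.  The base field enters through this division
    alone.

    From p to a phase space: the contragredient of p acts on h^*, and the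
    semidirect product of h and h^* for this action is a 3-Lie algebra
    ([semidirect_3Lie]) containing h and h^* as subalgebras.  The canonical
    form is closed for it because the bracket of h is the cyclic sum of p.

    From a phase space to p: since h is a subalgebra, the adjoint action of h
    on the phase space passes to the quotient by h, which is h^*
    ([phase_rho_rep]).  Its contragredient is a representation p of h on
    h^** = h, and the closedness of the canonical form, tested on three vectors
    and one covector, says that the cyclic sum of p is the bracket
    ([phase_preLie_subadjacent]). *)

(** * Linear functionals *)

(** Applying a functional turns an identity between vectors into an identity in
    the base field, where it can be decided by commutative ring normalization. *)
Lemma scalar_sep (K : fieldType) (V : vectType K) (u v : V) :
  (forall f : {scalar V}, f u = f v) -> u = v.
Proof.
move=> fuv; rewrite (coord_vbasis (memvf u)) (coord_vbasis (memvf v)).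
apply: eq_bigr => i _; congr (_ *: _).
exact: (fuv (coord (vbasis fullv) i)).
Qed.

(** * Representations of 3-Lie algebras *)

Record is_rep (K : fieldType) (g V : vectType K) (br : g -> g -> g -> g)
    (rho : g -> g -> V -> V) : Prop := {
  rep_linear1 : forall y v, linear (fun x => rho x y v);
  rep_linear2 : forall x v, linear (fun y => rho x y v);
  rep_linear3 : forall x y, linear (rho x y);
  rep_skew : forall x y v, rho x y v = - rho y x v;
  rep_der : forall x1 x2 x3 x4 v,
    rho x1 x2 (rho x3 x4 v) =
      rho (br x1 x2 x3) x4 v + rho x3 (br x1 x2 x4) v
      + rho x3 x4 (rho x1 x2 v);
  rep_cyc : forall x1 x2 x3 x4 v,
    rho (br x1 x2 x3) x4 v =
      rho x1 x2 (rho x3 x4 v) + rho x2 x3 (rho x1 x4 v)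
      + rho x3 x1 (rho x2 x4 v)
}.

Section Representation.
Variables (K : fieldType) (g V : vectType K) (br : g -> g -> g -> g).
Variables (rho : g -> g -> V -> V) (Hrho : is_rep br rho).

Lemma repD x y u v : rho x y (u + v) = rho x y u + rho x y v.
Proof. by have := rep_linear3 Hrho x y 1 u v; rewrite !scale1r. Qed.

Lemma rep0 x y : rho x y 0 = 0.
Proof. by apply: (addrI (rho x y 0)); rewrite -repD !addr0. Qed.

Lemma repN x y v : rho x y (- v) = - rho x y v.
Proof. by apply: (addrI (rho x y v)); rewrite -repD !subrr rep0. Qed.

(** Write S for the right-hand side of [rep_cyc] and T for the sum obtained by
    exchanging the two factors in each of its terms.  Summing [rep_der] over the
    cyclic permutations of x1, x2, x3 and expanding all brackets by [rep_cyc]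
    gives S - T = 3 S + (S + 2 T), that is 3 (S + T) = 0. *)
Lemma rep_anticyc x1 x2 x3 x4 v : 3%:R != 0 :> K ->
  rho (br x1 x2 x3) x4 v =
    - (rho x3 x4 (rho x1 x2 v) + rho x1 x4 (rho x2 x3 v)
       + rho x2 x4 (rho x3 x1 v)).
Proof.
move=> three_neq0; apply: scalar_sep => f.
have fder y1 y2 y3 y4 :
    f (rho y1 y2 (rho y3 y4 v)) - f (rho y3 y4 (rho y1 y2 v))
      - (f (rho (br y1 y2 y3) y4 v) - f (rho (br y1 y2 y4) y3 v)) = 0.
  by rewrite (rep_der Hrho) (rep_skew Hrho y3 (br _ _ _)); ring.
have fcyc y1 y2 y3 y4 : f (rho (br y1 y2 y3) y4 v) =
    f (rho y1 y2 (rho y3 y4 v)) + f (rho y2 y3 (rho y1 y4 v))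
    + f (rho y3 y1 (rho y2 y4 v)).
  by rewrite (rep_cyc Hrho) !linearD.
have skew_l y1 y2 y3 y4 :
    f (rho y1 y2 (rho y3 y4 v)) = - f (rho y2 y1 (rho y3 y4 v)).
  by rewrite (rep_skew Hrho) linearN.
have skew_r y1 y2 y3 y4 :
    f (rho y1 y2 (rho y3 y4 v)) = - f (rho y1 y2 (rho y4 y3 v)).
  by rewrite (rep_skew Hrho y3) repN linearN.
(* The goal is S + T = 0; multiply it by 3. *)
apply/eqP; rewrite -subr_eq0 -(mulrI_eq0 _ (mulfI three_neq0)); apply/eqP.
move: (fder x1 x2 x3 x4) (fder x2 x3 x1 x4) (fder x3 x1 x2 x4).
rewrite !fcyc linearN !linearD.
rewrite (skew_r x1 x2 x4 x3) (skew_r x2 x3 x4 x1) (skew_r x3 x1 x4 x2).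
rewrite (skew_l x4 x1) (skew_l x4 x2) (skew_l x4 x3).
rewrite (skew_r _ _ x1 x3) (skew_r _ _ x2 x1) (skew_r _ _ x3 x2).
move=> d1 d2 d3.
(* The sum of the three equations is - 3 (S + T) = 0. *)
have d := f_equal2 +%R (f_equal2 +%R d1 d2) d3.
by apply: etrans (etrans (congr1 -%R d) _); ring.
Qed.

End Representation.

(** * The contragredient representation *)

Section Contragredient.
Variables (K : fieldType) (g V W : vectType K) (br : g -> g -> g -> g).
Variables (pair : V -> W -> K) (rho : g -> g -> V -> V) (sigma : g -> g -> W -> W).

(** Stated for an abstract pairing, because it is used both for the evaluation
    of covectors at vectors and for the same pairing read from the other side,
    which stands for the identification of a space with its bidual.
    Transposing [rep_der] gives back [rep_der], and transposing [rep_anticyc]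
    gives [rep_cyc]. *)
Lemma rep_contragredient : 3%:R != 0 :> K ->
  bilinear_for *%R *%R pair -> (forall w, (forall v, pair v w = 0) -> w = 0) ->
  (forall x y v w, pair (rho x y v) w = - pair v (sigma x y w)) ->
  is_rep br rho -> is_rep br sigma.
Proof.
move=> three_neq0 [pairPl pairPr] nondeg adj Hrho.
have pairDl u v w : pair (u + v) w = pair u w + pair v w.
  by have := pairPl w 1 u v; rewrite scale1r /= mul1r.
have pair0l w : pair 0 w = 0.
  by apply: (addrI (pair 0 w)); rewrite -pairDl !addr0.
have pairZl a u w : pair (a *: u) w = a * pair u w.
  by have := pairPl w a u 0; rewrite pair0l !addr0.
have pairNl u w : pair (- u) w = - pair u w by rewrite -scaleN1r pairZl mulN1r.
have pairDr u v w : pair u (v + w) = pair u v + pair u w.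
  by have := pairPr u 1 v w; rewrite scale1r /= mul1r.
have pair0r u : pair u 0 = 0.
  by apply: (addrI (pair u 0)); rewrite -pairDr !addr0.
have pairZr a u w : pair u (a *: w) = a * pair u w.
  by have := pairPr u a w 0; rewrite pair0r !addr0.
have pairNr u w : pair u (- w) = - pair u w by rewrite -scaleN1r pairZr mulN1r.
have sep w w' : (forall v, pair v w = pair v w') -> w = w'.
  move=> eq_ww'; apply/eqP; rewrite -subr_eq0; apply/eqP/nondeg => v.
  by rewrite pairDr pairNr eq_ww' subrr.
have adj' x y v w : pair v (sigma x y w) = - pair (rho x y v) w.
  by rewrite adj opprK.
split.
- move=> y w a x1 x2; apply: sep => v.
  rewrite pairDr pairZr !adj' (rep_linear1 Hrho) pairDl pairZl; ring.
- move=> x w a y1 y2; apply: sep => v.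
  rewrite pairDr pairZr !adj' (rep_linear2 Hrho) pairDl pairZl; ring.
- move=> x y a w1 w2; apply: sep => v.
  rewrite pairDr pairZr !adj' pairDr pairZr; ring.
- move=> x y w; apply: sep => v.
  by rewrite pairNr !adj' (rep_skew Hrho) pairNl.
- move=> x1 x2 x3 x4 w; apply: sep => v.
  rewrite !pairDr !adj' (rep_der Hrho x1 x2 x3 x4) !pairDl; ring.
- move=> x1 x2 x3 x4 w; apply: sep => v.
  rewrite !pairDr !adj' (rep_anticyc Hrho _ _ _ _ _ three_neq0).
  by rewrite !(pairNl, pairDl); ring.
Qed.

End Contragredient.

(** * Two sources of representations *)

Lemma preLie_rep (K : fieldType) (A : vectType K) (br p : A -> A -> A -> A) :
  is_3preLie p -> (forall x y z, br x y z = subadjacent p x y z) -> is_rep br p.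
Proof.
move=> [[l1 l2 l3] skew der cyc] brE.
by split => // x1 x2 x3 x4 v; rewrite !brE.
Qed.

Lemma rep_preLie (K : fieldType) (A : vectType K) (br p : A -> A -> A -> A) :
  is_rep br p -> (forall x y z, br x y z = subadjacent p x y z) -> is_3preLie p.
Proof.
move=> [l1 l2 l3 skew der cyc] brE.
by split => // x1 x2 x3 x4 v; rewrite -!brE.
Qed.

(** In a 3-Lie algebra [rep_cyc] is the fundamental identity again: it expands
    the derivation [x4, v, -] applied to the bracket of x1, x2, x3. *)
Lemma ad_rep (K : fieldType) (g : vectType K) (br : g -> g -> g -> g) :
  is_3Lie br -> is_rep br br.
Proof.
move=> [[t1 t2 t3] skew12 skew23 fund].
have br_rot x y z : br x y z = br y z x by rewrite skew12 skew23 opprK.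
split => // x1 x2 x3 x4 v.
rewrite (br_rot (br x1 x2 x3)) fund addrC addrA.
rewrite (br_rot (br x4 v x1)) -(br_rot x3 x1).
by rewrite (br_rot x1 x4) (br_rot x2 x4) (br_rot x3 x4).
Qed.

(** * The semidirect product *)

Section Semidirect.
Variables (K : fieldType) (g V : vectType K) (br : g -> g -> g -> g).
Variable (rho : g -> g -> V -> V).

Definition semidirect (u v w : g * V) : g * V :=
  (br u.1 v.1 w.1,
   rho u.1 v.1 w.2 + rho v.1 w.1 u.2 + rho w.1 u.1 v.2).

(** In the V-component of the fundamental identity each term contains exactly
    one of the five V-parts.  The terms in a3, a4 and a5 cancel by [rep_der],
    and those in a1 and a2 by [rep_cyc]. *)
Lemma semidirect_3Lie : is_3Lie br -> is_rep br rho -> is_3Lie semidirect.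
Proof.
move=> [[t1 t2 t3] skew12 skew23 fund] Hrho.
have [l1 l2 l3 skew der cyc] := Hrho.
split; first split.
- move=> [y b] [z c] k [x a] [x' a']; congr (_, _) => /=; first exact: t1.
  by apply: scalar_sep => f; rewrite l1 l2 l3 !(linearD, linearZ) /=; ring.
- move=> [x a] [z c] k [y b] [y' b']; congr (_, _) => /=; first exact: t2.
  by apply: scalar_sep => f; rewrite l1 l2 l3 !(linearD, linearZ) /=; ring.
- move=> [x a] [y b] k [z c] [z' c']; congr (_, _) => /=; first exact: t3.
  by apply: scalar_sep => f; rewrite l1 l2 l3 !(linearD, linearZ) /=; ring.
- move=> [x a] [y b] [z c]; congr (_, _) => /=; first exact: skew12.
  rewrite (skew x y) (skew y z) (skew z x).
  by apply: scalar_sep => f; ring.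
- move=> [x a] [y b] [z c]; congr (_, _) => /=; first exact: skew23.
  rewrite (skew x y) (skew y z) (skew z x).
  by apply: scalar_sep => f; ring.
move=> [x1 a1] [x2 a2] [x3 a3] [x4 a4] [x5 a5].
congr (_, _) => /=; first exact: fund.
have br_rot x y z : br x y z = br y z x by rewrite skew12 skew23 opprK.
(* This is [rep_cyc] for a bracket in the second argument, the position in
   which it acts on a1. *)
have left_arg x y z t v : rho t (br x y z) v =
    - (rho x y (rho z t v) + rho y z (rho x t v) + rho z x (rho y t v)).
  by rewrite skew cyc.
rewrite !(repD Hrho).
rewrite (der x1 x2 x3 x4) (der x1 x2 x4 x5) (der x1 x2 x5 x3).
rewrite (left_arg x3 x4 x5 x2 a1) (cyc x3 x4 x5 x1 a2).
rewrite (skew x5 x2 a1) (skew x4 x2 a1) (skew x3 x2 a1) !(repN Hrho).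
by apply: scalar_sep => f; ring.
Qed.

End Semidirect.

(** * The dual space *)

Section Dual.
Variables (K : fieldType) (h : vectType K).
Implicit Types (a b : 'Hom(h, K^o)) (x : h).

Lemma linfun_linear (U W : vectType K) (f : U -> W) : linear f -> linfun f =1 f.
Proof.
move=> linf; pose F : {linear U -> W} :=
  HB.pack f (GRing.isLinear.Build K U W _ f linf).
exact: (lfunE F).
Qed.

Lemma dual_sep x : (forall a, a x = 0) -> x = 0.
Proof.
move=> ax0; apply: scalar_sep => f; rewrite linear0.
have := ax0 (linfun (f : h -> K^o)); rewrite linfun_linear //.
by move=> k u v; rewrite linearP.
Qed.

Lemma eval_bilinear : bilinear_for *%R *%R (fun a x => a x : K).
Proof.
split=> [x k a b | a k x y] /=; first by rewrite add_lfunE scale_lfunE.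
by rewrite linearP.
Qed.

(** The vector that represents a functional on the dual space, that is its
    preimage under the isomorphism of h with its bidual. *)
Definition dual_repr (phi : 'Hom(h, K^o) -> K) : h :=
  let e := vbasis (fullv : {vspace h}) in
  \sum_i phi (linfun (coord e i : h -> K^o)) *: e`_i.

Lemma dual_reprE phi : scalar phi -> forall a, a (dual_repr phi) = phi a.
Proof.
move=> linphi a; pose F : {scalar 'Hom(h, K^o)} :=
  HB.pack phi (GRing.isLinear.Build K _ _ _ phi linphi).
set e := vbasis (fullv : {vspace h}).
have coordE i : linfun (coord e i : h -> K^o) =1 coord e i.
  by apply: linfun_linear => k u v; rewrite linearP.
have aE : a = \sum_(i < \dim {:h}) a e`_i *: linfun (coord e i : h -> K^o).
  apply/lfunP => x; rewrite {1}(coord_vbasis (memvf x)) linear_sum sum_lfunE.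
  by apply: eq_bigr => i _; rewrite linearZ scale_lfunE coordE; exact: mulrC.
rewrite /dual_repr -/e linear_sum {2}aE -[phi]/(F : _ -> _) linear_sum.
by apply: eq_bigr => i _; rewrite !linearZ; exact: mulrC.
Qed.

End Dual.

(** * The canonical form and the phase space of a 3-pre-Lie product *)

Section PhaseSpace.
Variables (K : fieldType) (h : vectType K) (br : h -> h -> h -> h).
Local Notation hd := 'Hom(h, K^o).

Lemma omega_bilinear : bilinear_for *%R *%R (@omega K h).
Proof.
split=> [[y b] k [x a] [x' a'] | [x a] k [y b] [y' b']]; rewrite /omega /=.
  by rewrite add_lfunE scale_lfunE linearP /= /GRing.scale /=; ring.
by rewrite add_lfunE scale_lfunE linearP /= /GRing.scale /=; ring.
Qed.

Lemma omega_nondeg (u : h * hd) : (forall v, omega u v = 0) -> u = 0.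
Proof.
case: u => x a om0; congr (_, _).
  apply: dual_sep => b; have := om0 (0, b); rewrite /omega /= linear0 sub0r.
  by move/eqP; rewrite oppr_eq0 => /eqP.
apply/lfunP => y; have := om0 (y, 0).
by rewrite /omega /= !zero_lfunE subr0.
Qed.

Definition coadjoint (p : h -> h -> h -> h) (x y : h) (a : hd) : hd :=
  linfun (fun z => - a (p x y z)).

Lemma coadjointE p x y a z : (forall x y, linear (p x y)) ->
  coadjoint p x y a z = - a (p x y z).
Proof.
move=> linp; rewrite linfun_linear // => k u v.
by rewrite linp linearP opprD scalerN.
Qed.

Hypothesis three_neq0 : 3%:R != 0 :> K.

(** Closedness of [omega] splits into one identity for each of the four
    covectors.  In the one for d, for instance, the terms coming from the
    contragredient action are exactly the cyclic sum of p, which the bracket of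
    h cancels. *)
Lemma preLie_phase_space p : is_3Lie br -> is_3preLie p ->
  (forall x y z, br x y z = subadjacent p x y z) ->
  is_phase_space br (semidirect br (coadjoint p)).
Proof.
move=> Hbr Hp brE.
have linp : forall x y, linear (p x y) := trilinear3 (preLie_trilinear Hp).
have Hco : is_rep br (coadjoint p).
  apply: (@rep_contragredient _ _ _ _ _ (fun x (a : hd) => a x : K) p) => //.
  - by split; [exact: (eval_bilinear h).2 | exact: (eval_bilinear h).1].
  - by move=> a a0; apply/lfunP => x; rewrite a0 zero_lfunE.
  - by move=> x y z a; rewrite coadjointE // opprK.
  - exact: preLie_rep.
split; first exact: semidirect_3Lie.
- split; [exact: omega_bilinear | | exact: omega_nondeg |].
    by move=> u v; rewrite /omega opprB.
  move=> [x a] [y b] [z c] [t d]; rewrite /omega /=.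
  rewrite !add_lfunE !coadjointE // !brE /subadjacent !linearD /=.
  have skew s u v w : (s : hd) (p u v w) = - s (p v u w).
    by rewrite (preLie_skew Hp) linearN.
  by rewrite !(skew _ z x) !(skew _ t y); ring.
- by move=> x y z; rewrite /semidirect /= !(rep0 Hco) !addr0.
(* The h-component of a bracket of covectors is the bracket of zeros in h. *)
move=> a b c; eexists; congr (_, _); rewrite /=.
exact: (rep0 (ad_rep Hbr)).
Qed.

(** * The 3-pre-Lie product of a phase space *)

Section PhaseSpaceRep.
Variable B : h * hd -> h * hd -> h * hd -> h * hd.
Hypothesis phB : is_phase_space br B.

(** The bracket of x, y and a covector may have a component in h; keeping only
    its h^*-component amounts to working in the quotient of the phase space
    by h. *)
Definition phase_rho (x y : h) (a : hd) : hd := (B (x, 0) (y, 0) (0, a)).2.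

(** Because h is a subalgebra, the action of h is well defined on that
    quotient: the h-component of u does not contribute. *)
Lemma phase_rhoE x y u : (B (x, 0) (y, 0) u).2 = phase_rho x y u.2.
Proof.
have Had := ad_rep (phase_space_Lie phB).
have -> : u = (u.1, 0) + (0, u.2).
  by rewrite {1}[u]surjective_pairing; congr (_, _); rewrite /= ?addr0 ?add0r.
by rewrite (repD Had) (phase_space_sub phB) /= !add0r.
Qed.

Lemma phase_rho_rep : is_rep br phase_rho.
Proof.
have [l1 l2 l3 skew der cyc] := ad_rep (phase_space_Lie phB).
have inj1 k x y : (k *: x + y, 0) = k *: (x, 0) + (y, 0) :> h * hd.
  by congr (_, _); rewrite /= scaler0 addr0.
have inj2 k a b : (0, k *: a + b) = k *: (0, a) + (0, b) :> h * hd.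
  by congr (_, _); rewrite /= scaler0 addr0.
split.
- by move=> y a k x1 x2; rewrite /phase_rho inj1 l1.
- by move=> x a k y1 y2; rewrite /phase_rho inj1 l2.
- by move=> x y k a1 a2; rewrite /phase_rho inj2 l3.
- by move=> x y a; rewrite /phase_rho skew.
- move=> x1 x2 x3 x4 a; rewrite -!phase_rhoE /phase_rho der /=.
  by rewrite !(phase_space_sub phB).
- move=> x1 x2 x3 x4 a; rewrite -!phase_rhoE /phase_rho.
  by rewrite -(phase_space_sub phB) cyc.
Qed.

Definition phase_preLie (x y z : h) : h :=
  dual_repr (fun a => - phase_rho x y a z).

Lemma phase_preLieE x y z (a : hd) :
  a (phase_preLie x y z) = - phase_rho x y a z.
Proof.
rewrite dual_reprE // => k b c.
rewrite (rep_linear3 phase_rho_rep) add_lfunE scale_lfunE /= /GRing.scale /=.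
ring.
Qed.

(** By nondegeneracy it suffices to test the equality on a covector a, where it
    is the closedness of [omega] at x, y, z and a. *)
Lemma phase_preLie_subadjacent x y z :
  br x y z = subadjacent phase_preLie x y z.
Proof.
apply/eqP; rewrite -subr_eq0; apply/eqP/dual_sep => a.
rewrite linearB !linearD /= !phase_preLieE.
have HL := phase_space_Lie phB.
have := symplectic_closed (phase_space_symplectic phB) (x, 0) (y, 0) (z, 0) (0, a).
rewrite (Lie_skew23 HL (z, 0)) (Lie_skew12 HL (0, a)) (Lie_skew23 HL (x, 0) (0, a)).
rewrite opprK (phase_space_sub phB) /omega /=.
rewrite -/(phase_rho _ _ _) -/(phase_rho _ _ _) -/(phase_rho _ _ _).
rewrite !zero_lfunE opp_lfunE => closed.
by rewrite -[RHS]oppr0 -closed; ring.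
Qed.

Lemma phase_preLie_3preLie : is_3preLie phase_preLie.
Proof.
apply: rep_preLie phase_preLie_subadjacent.
apply: (rep_contragredient three_neq0 (eval_bilinear h)) phase_rho_rep.
  exact: dual_sep.
by move=> x y a z; rewrite phase_preLieE opprK.
Qed.

End PhaseSpaceRep.
End PhaseSpace.

Theorem theorem4p5 (R : realType) (K : fieldType)
    (hK : K = R :> fieldType \/ K = R[i] :> fieldType)
    (h : vectType K) (br : h -> h -> h -> h) (hbr : is_3Lie br) :
  (exists B : h * 'Hom(h, K^o) -> h * 'Hom(h, K^o) -> h * 'Hom(h, K^o) ->
              h * 'Hom(h, K^o),
     is_phase_space br B)
  <->
  (exists p : h -> h -> h -> h,
     is_3preLie p /\ forall x y z : h, br x y z = p x y z + p y z x + p z x y).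
Proof.
have three_neq0 : 3%:R != 0 :> K.
  by case: hK => eqK; rewrite eqK Num.Theory.pnatr_eq0.
split=> [[B phB] | [p [Hp brE]]].
  exists (phase_preLie B); split; first exact: (phase_preLie_3preLie three_neq0 phB).
  exact: phase_preLie_subadjacent phB.
exists (semidirect br (coadjoint p)).
exact: preLie_phase_space.
Qed.
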